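(* There is a numerical constant $c$ such that the following holds. Suppose that there are $B,\eta>0$ such that for all $y\in\mathcal{Y}$ the function $\ell(\cdot,y)$ is $\eta$-exp-concave on $\mathcal{X}$ and $\sup_{x,x'\in\mathcal{X}}|\ell(x,y)-\ell(x',y)|\le B$. Consider the case ($p=2$ and $m\ge3$) or ($p=2$, $m=2$ and $\mathrm{IC}=\mathrm{False}$). For any input parameter $\lambda\in\left(0,\frac{m-1}{128K}\bar\lambda\right)$ and any $\delta\in(0,1)$, the regret of the algorithm described in the context, run with parameters $\lambda,m$, satisfies with probability at least $1-8\delta$ with respect to the player's own randomization $$\mathcal{R}_T\le c\,\frac1\lambda\log\left(\frac{\bar\lambda K}{\lambda\delta}\right).$$
   Context: Write $[n]=\{1,\dots,n\}$. $\mathcal{X}$ is a closed convex subset of a real vector space, $\mathcal{Y}$ an outcome space, $\ell:\mathcal{X}\times\mathcal{Y}\to\mathbb{R}$ a loss function; $f$ is $\eta$-exp-concave if $\exp(-\eta f)$ is concave. Fixed (deterministic, unknown to the learner) sequences are given: outcomes $y_t\in\mathcal{Y}$ and expert predictions $F_{i,t}\in\mathcal{X}$, for $i\in[K]$, $t\in[T]$. Put $\ell_{i,t}=\ell(F_{i,t},y_t)$. If the learner plays $z_t\in\mathcal{X}$ at round $t$, its regret is $\mathcal{R}_T=\sum_{t=1}^T\ell(z_t,y_t)-\min_{i\in[K]}\sum_{t=1}^T\ell_{i,t}$. In each round the learner may combine $p$ experts for its prediction and observe the losses of at most $m\le K$ experts; $\mathrm{IC}=\mathrm{True}$ means that the experts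 used for prediction are required to be among the observed ones, $\mathrm{IC}=\mathrm{False}$ means that this is not required. Define $$\bar\lambda:=\min\left\{\frac{4\log\left(1+\frac{\eta^2B^2}{2}\right)}{\eta B^2},\ \frac1B\right\}.$$ Algorithm (inputs $\lambda,m$): set $\tilde m=\max\{m-2,1\}$ and $\hat L_{i,0}=\hat V_{i,0}=0$ for all $i\in[K]$. At each round $t=1,2,\dots$: let $$\hat p_{i,t}=\frac{\exp\left(-\lambda\hat L_{i,t-1}+\lambda^2\hat V_{i,t-1}\right)}{\sum_{j=1}^K\exp\left(-\lambda\hat L_{j,t-1}+\lambda^2\hat V_{j,t-1}\right)};$$ sample $I_t$ and $J_t$ from $[K]$ independently according to $\hat p_t$; play $z_t=\frac12F_{I_t,t}+\frac12F_{J_t,t}$ and incur its loss; sample, independently, a set $\mathcal{U}_t$ of $\tilde m$ experts uniformly at random without replacement from $[K]$; let $C_t=\{I_t,J_t\}\cup\mathcal{U}_t$ if $m\ge3$ and $C_t=\{I_t\}\cup\mathcal{U}_t$ if $m=2$; observe $\ell_{i,t}$ for $i\in C_t$; for every $i\in[K]$ let $$\hat\ell_{i,t}=\frac{K}{\tilde m}\mathbf{1}(i\in\mathcal{U}_t)\,\ell_{i,t}+\left(1-\frac{K}{\tilde m}\mathbf{1}(i\in\mathcal{U}_t)\right)\ell_{I_t,t},\qquad \hat v_{i,t}=\left(\hat\ell_{i,t}-\ell_{I_t,t}\right)^2,$$ and update $\hat L_{i,t}=\hat L_{i,t-1}+\hat\ell_{i,t}$, $\hat V_{i,t}=\hat V_{i,t-1}+\hat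 v_{i,t}$. *)

(* Defs.v *)
From mathcomp Require Import all_boot all_order all_algebra.
From mathcomp Require Import all_classical all_reals all_analysis.

Set Implicit Arguments.
Unset Strict Implicit.
Unset Printing Implicit Defensive.

Import Order.TTheory GRing.Theory Num.Theory.

Local Open Scope classical_set_scope.
Local Open Scope ring_scope.

Section LossFunction.
Variables (R : realType) (V : lmodType R).

Definition concave_function (X : set V) (f : V -> R) : Prop :=
  convex_function (X : set (convex_lmodType V)) (fun x => - f x).

Definition exp_concave (eta : R) (X : set V) (f : V -> R) : Prop :=
  concave_function X (fun x => expR (- eta * f x)).

(* The supremum is taken in the extended reals: on an unbounded set of reals,
   the real-valued [sup] is a default value. *)
Definition loss_range (X : set V) (f : V -> R) : \bar R :=
  ereal_sup [set (`|f x - f x'|)%:E | x in X & x' in X].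

End LossFunction.

Definition lambda_bar (R : realType) (eta B : R) : R :=
  Num.min (4 * ln (1 + eta ^+ 2 * B ^+ 2 / 2) / (eta * B ^+ 2)) (1 / B).

(* The draws (I_t, J_t, U_t) made by the learner in one round. *)
Definition draw (K : nat) : Type := ('I_K * 'I_K * {set 'I_K})%type.

(* The draws over a whole run; rounds are numbered from 0 to T-1. *)
Definition run (K T : nat) : Type := {ffun 'I_T -> draw K}.

Section Algorithm.
Variables (R : realType) (K T m : nat) (lambda : R).
(* loss i t is the loss of expert i at round t *)
Variable loss : 'I_K -> 'I_T -> R.

Definition m_tilde : nat := maxn (m - 2) 1.

Definition drawI (w : run K T) (t : 'I_T) : 'I_K := (w t).1.1.
Definition drawJ (w : run K T) (t : 'I_T) : 'I_K := (w t).1.2.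
Definition drawU (w : run K T) (t : 'I_T) : {set 'I_K} := (w t).2.

(* The set C_t. The algorithm is only run with 2 <= m. *)
Definition observed (w : run K T) (t : 'I_T) : {set 'I_K} :=
  if (3 <= m)%N then [set drawI w t; drawJ w t]%SET :|: drawU w t
  else drawI w t |: drawU w t.

Definition loss_hat (w : run K T) (i : 'I_K) (t : 'I_T) : R :=
  let a := K%:R / m_tilde%:R * (i \in drawU w t)%:R in
  a * loss i t + (1 - a) * loss (drawI w t) t.

Definition v_hat (w : run K T) (i : 'I_K) (t : 'I_T) : R :=
  (loss_hat w i t - loss (drawI w t) t) ^+ 2.

(* The values of the cumulative estimates at the beginning of round t. *)
Definition L_hat (w : run K T) (i : 'I_K) (t : 'I_T) : R :=
  \sum_(s < T | (s < t)%N) loss_hat w i s.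

Definition V_hat (w : run K T) (i : 'I_K) (t : 'I_T) : R :=
  \sum_(s < T | (s < t)%N) v_hat w i s.

Definition weight (w : run K T) (i : 'I_K) (t : 'I_T) : R :=
  expR (- lambda * L_hat w i t + lambda ^+ 2 * V_hat w i t).

Definition p_hat (w : run K T) (i : 'I_K) (t : 'I_T) : R :=
  weight w i t / \sum_(j < K) weight w j t.

(* Uniform law on the subsets of [K] with m_tilde elements. *)
Definition unif_subset (U : {set 'I_K}) : R :=
  (#|U| == m_tilde)%:R / 'C(K, m_tilde)%:R.

(* Conditional probability of the draws of round t in the run w, given the
   draws of the earlier rounds (on which alone p_hat w _ t depends). *)
Definition draw_prob (w : run K T) (t : 'I_T) : R :=
  p_hat w (drawI w t) t * p_hat w (drawJ w t) t * unif_subset (drawU w t).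

Definition run_prob (w : run K T) : R := \prod_(t < T) draw_prob w t.

Definition Pr (E : pred (run K T)) : R := \sum_(w : run K T | E w) run_prob w.

End Algorithm.

Section Regret.
Variables (R : realType) (V : lmodType R) (Y : Type) (K T : nat).
Variables (l : V -> Y -> R) (F : 'I_K -> 'I_T -> V) (y : 'I_T -> Y).

Definition expert_loss (i : 'I_K) (t : 'I_T) : R := l (F i t) (y t).

Definition prediction (w : run K T) (t : 'I_T) : V :=
  2^-1 *: F (drawI w t) t + 2^-1 *: F (drawJ w t) t.

(* For 0 < K the infimum is over a finite nonempty set, hence a minimum. *)
Definition regret (w : run K T) : R :=
  \sum_(t < T) l (prediction w t) (y t)
  - inf (range (fun i : 'I_K => \sum_(t < T) expert_loss i t)).

End Regret.

(* The algorithm obeys the protocol with parameters p, m and IC: it combines at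
   most p experts, observes at most m, and, if IC is required, observes those
   that it combines. The draws of positive probability satisfy HU. *)
Lemma observed_admissible (K T p m : nat) (IC : bool) (w : run K T) (t : 'I_T)
    (HU : #|drawU w t| = m_tilde m) :
  (p = 2%N /\ (3 <= m)%N) \/ [/\ p = 2%N, m = 2%N & IC = false] ->
  [/\ (#|[set drawI w t; drawJ w t]%SET| <= p)%N,
      (#|observed m w t| <= m)%N &
      IC -> [set drawI w t; drawJ w t]%SET \subset observed m w t].
Proof.
have c2 : (#|[set drawI w t; drawJ w t]%SET| <= 2)%N
  by rewrite cards2; case: (_ == _).
case=> [[-> m3]|[-> m2 ->]]; split=> //; rewrite /observed ?m3 //.
  apply: leq_trans (leq_card_setU _ _) _; rewrite HU /m_tilde.
  rewrite (maxn_idPl _) ?subn_gt0 //.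
  by rewrite -[leqRHS](subnKC (ltnW m3)) leq_add2r.
  by move=> _; rewrite finset.subsetUl.
by rewrite m2 ltnn cardsU1 HU m2 (leq_add (leq_b1 _) (leqnn 1)).
Qed.

(* The estimates depend on the losses only through the observed ones. *)
Lemma loss_hat_observed (R : realType) (K T m : nat)
    (loss loss' : 'I_K -> 'I_T -> R) (w : run K T) (t : 'I_T) :
  (forall i, i \in observed m w t -> loss i t = loss' i t) ->
  forall i, loss_hat m loss w i t = loss_hat m loss' w i t.
Proof.
move=> eql i; rewrite /loss_hat.
rewrite (eql (drawI w t)); last first.
  by rewrite /observed; case: ifP; rewrite !inE eqxx.
have [iU|] := boolP (i \in drawU w t); last by rewrite mulr0 !mul0r.
by rewrite eql // /observed; case: ifP; rewrite !inE iU !orbT.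
Qed.

(* Main.v *)
Require Import Defs.
From mathcomp Require Import all_boot all_order all_algebra.
From mathcomp Require Import all_classical all_reals all_analysis.
From mathcomp Require Import ring lra zify.

Set Implicit Arguments.
Unset Strict Implicit.
Unset Printing Implicit Defensive.

Import Order.TTheory GRing.Theory Num.Theory.

Local Open Scope classical_set_scope.
Local Open Scope ring_scope.

(** Write [avg w t] for the loss at round [t] averaged under [p_hat w _ t], and
    [var w t] for the mean square of [loss I t - loss J t], which is twice the
    variance of the loss. Three quantities are compared.

    - Prediction. Exp-concavity makes the midpoint of two experts better than
      the average of their losses by [lambda_bar / 16] times the squared
      difference of these losses ([exp_concave_midpoint]). The learner thus
      suffers about [avg w t - lambda_bar / 16 * var w t], up to fluctuations
      whose second moment is at most [var w t]. As [lambda <= lambda_bar / 64],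
      the gain pays for the second-order term of an exponential moment of
      parameter [lambda], and [3 / 64 * lambda_bar * var w t] is left over.
    - Aggregation. The total weight changes at round [t] by a factor whose
      logarithm has mean at most [3 * lambda ^+ 2 * (K / m_tilde) * var w t],
      once the loss of the expert [I_t] is subtracted from all estimates. As
      [lambda * (K / m_tilde) <= lambda_bar / 64], what the prediction has left
      over pays for this as well.
    - Estimation. The total weight is at least the weight of the best expert
      [i]. The correction [lambda ^+ 2 * V_hat] in the weights is there because
      of [expR (x - x ^+ 2) <= 1 + x]: the exponential of the estimated loss of
      [i], minus the square, has a mean controlled by the true loss alone,
      without any variance term.

    Each of the three statements says that the product over the rounds of some
    positive factors ([midpoint_factor], [mixture_factor], [expert_factor]) has
    mean at most [1], since the conditional mean of every factor is at most [1]
    ([supermartingale_mean]). The product of the three is at least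
    [expR (lambda * regret) / K], because the averages and the variances cancel
    ([prod_factors_ge]). Hence, where [lambda * regret] exceeds
    [3 * ln (K / delta)], one of the three products is at least [delta^-1], and
    Markov's inequality bounds the probability of this by [3 * delta]. The
    logarithm of the theorem is larger than [ln (K / delta)], as
    [lambda <= lambda_bar]. *)

(** * Elementary inequalities for the exponential *)

Lemma expR_ge_taylor2 (R : realType) (u : R) :
  0 <= u -> 1 + u + u ^+ 2 / 2 <= expR u.
Proof.
move=> u0.
have -> : 1 + u + u ^+ 2 / 2 = series (exp_coeff u) 3%N.
  rewrite /series /= big_nat_recl // big_nat_recl // big_nat1 /exp_coeff /=.
  by rewrite expr0 expr1 !divr1 addrA.
apply: nondecreasing_cvgn_le; last exact: is_cvg_series_exp_coeff.
by apply: nondecreasing_series => n _ _; exact: exp_coeff_ge0.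
Qed.

(** By [expR x + expR (- x) - 2 = (expR (x / 2) - expR (- x / 2)) ^+ 2], it is
    enough that [2 * u <= expR u - expR (- u)] for [u >= 0], which
    follows from [expR_ge_taylor2] and [(1 + u ^+ 2 / 2) ^+ 2 >= 1 + u ^+ 2]. *)
Lemma cosh_lower (R : realType) (x : R) :
  2 + x ^+ 2 <= expR x + expR (- x).
Proof.
wlog x0 : x / 0 <= x.
  move=> H; have [/H //|/ltW] := leP 0 x.
  by rewrite -oppr_ge0 => /H; rewrite opprK sqrrN addrC [expR _ + _]addrC addrC.
have u0 : 0 <= x / 2 by lra.
have := expR_ge_taylor2 u0; set u := x / 2 in u0 *; set s := expR u => su.
have s0 : 0 < s by exact: expR_gt0.
have -> : x = u + u by rewrite /u; lra.
rewrite opprD !expRD !expRN -/s.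
have h : 2 * u <= s - s^-1.
  rewrite -(ler_pM2l s0) mulrBr divff ?gt_eqF// -subr_ge0.
  have -> : s * s - 1 - s * (2 * u) = (s - u) ^+ 2 - (1 + u ^+ 2) by ring.
  have h1 : 1 + u ^+ 2 / 2 <= s - u by lra.
  have h2 : (1 + u ^+ 2 / 2) ^+ 2 <= (s - u) ^+ 2.
    by rewrite ler_sqr ?nnegrE //; have := sqr_ge0 u; lra.
  have := sqr_ge0 (u ^+ 2); lra.
have h3 : (2 * u) ^+ 2 <= (s - s^-1) ^+ 2.
  by rewrite ler_sqr ?nnegrE; lra.
have sV : s * s^-1 = 1 by rewrite divff ?gt_eqF.
have : (s - s^-1) ^+ 2 = s * s + s^-1 * s^-1 - 2 * (s * s^-1) by ring.
rewrite sV; lra.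
Qed.

(** The square of [expR_ge1Dx] at [x / 2] has a quadratic term, which
    [expR_ge1Dx] lacks, and unlike [expR_ge_taylor2] covers negative [x]. *)
Lemma expR_ge_sqr (R : realType) (x : R) :
  -2 <= x -> (1 + x / 2) ^+ 2 <= expR x.
Proof.
move=> x2; have -> : x = x / 2 + x / 2 by lra.
rewrite expRD -expr2 ler_sqr ?nnegrE ?expR_ge0 //; last lra.
by apply: le_trans (expR_ge1Dx _); lra.
Qed.

(** Applying [expR_ge_sqr] to [- x] bounds [expR x] from above by a rational
    function, which is at most the polynomial for small [x]. *)
Lemma expR_le_poly2 (R : realType) (x : R) :
  `|x| <= 1 / 4 -> expR x <= 1 + x + x ^+ 2.
Proof.
rewrite ler_norml => /andP[x1 x2].
have q0 : 0 < 1 + x + x ^+ 2 by have := sqr_ge0 x; lra.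
rewrite -[expR x]invrK -expRN -[leRHS]invrK lef_pV2 ?posrE ?invr_gt0 ?expR_gt0 //.
have x22 : -2 <= - x by lra.
apply: le_trans (expR_ge_sqr x22).
rewrite -[leLHS]mul1r ler_pdivrMr // -subr_ge0.
have -> : (1 + - x / 2) ^+ 2 * (1 + x + x ^+ 2) - 1
   = x ^+ 2 / 4 * (1 - 3 * x + x ^+ 2) by field.
by rewrite mulr_ge0 // ?divr_ge0 ?sqr_ge0 //; have := sqr_ge0 x; lra.
Qed.

Lemma expR_subsqr_le (R : realType) (x : R) :
  `|x| <= 1 / 4 -> expR (x - x ^+ 2) <= 1 + x.
Proof.
rewrite ler_norml => /andP[x1 x2].
have q0 : 0 < 1 + x by lra.
have s2 : x ^+ 2 <= 1 / 16.
  have := mulr_ge0 (_ : 0 <= 1 / 4 - x) (_ : 0 <= 1 / 4 + x).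
  by rewrite expr2; move=> H; have := H _ _; lra.
rewrite -[expR _]invrK -expRN -[leRHS]invrK lef_pV2 ?posrE ?invr_gt0 ?expR_gt0 //.
have x22 : -2 <= - (x - x ^+ 2) by have := sqr_ge0 x; lra.
apply: le_trans (expR_ge_sqr x22).
rewrite -[leLHS]mul1r ler_pdivrMr // -subr_ge0.
have -> : (1 + - (x - x ^+ 2) / 2) ^+ 2 * (1 + x) - 1
   = x ^+ 2 / 4 * (1 + x * (3 - x + x ^+ 2)) by field.
apply: mulr_ge0; first by rewrite divr_ge0 ?sqr_ge0.
have : 0 <= (x + 1 / 4) * (3 - x + x ^+ 2).
  by rewrite mulr_ge0 //; have := sqr_ge0 x; lra.
lra.
Qed.

Lemma expR_addsqr_le (R : realType) (x : R) :
  `|x| <= 1 / 64 -> expR (- x + x ^+ 2) <= 1 - x + 3 * x ^+ 2.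
Proof.
move=> xn; have := xn; rewrite ler_norml => /andP[x1 x2].
have s0 := sqr_ge0 x.
have s2 : x ^+ 2 <= 1 / 64 * (1 / 64).
  by rewrite -real_normK ?num_real // expr2 ler_pM.
have h : `|- x + x ^+ 2| <= 1 / 4 by rewrite ler_norml; lra.
apply: le_trans (expR_le_poly2 h) _.
have -> : (- x + x ^+ 2) ^+ 2 = x ^+ 2 * (1 - x) ^+ 2 by ring.
have : x ^+ 2 * (1 - x) ^+ 2 <= x ^+ 2 * 2.
  by apply: ler_wpM2l => //; rewrite sqrrB; lra.
lra.
Qed.

(** * Gain of the midpoint prediction *)

(** Bernoulli's inequality, as the convexity of [expR] between [0] and
    [ln (1 + x)]. *)
Lemma expR_mul_ln_le (R : realType) (th x : R) :
  0 <= th <= 1 -> 0 <= x -> expR (th * ln (1 + x)) <= 1 + th * x.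
Proof.
move=> /andP[th0 th1] x0.
have th01 : Itv.spec (Itv.num_sem (R:=R)) (Itv.Real `[0%Z, 1%Z]) th.
  by rewrite /= /Itv.num_sem /= in_itv /= th0 th1 realE th0.
have := convex_expR (Itv.Def th01) (ln (1 + x)) 0.
rewrite !convRE /= expR0 lnK ?posrE; last lra.
rewrite mulr0 addr0 /unstable.onem; lra.
Qed.

(** With [d := f x - f x'], concavity gives
    [expR (- eta * f mid) >= expR (- eta * (f x + f x') / 2) * cosh (eta * d / 2)],
    and [cosh (eta * d / 2) >= 1 + eta ^+ 2 * d ^+ 2 / 8], which Bernoulli's
    inequality with exponent [d ^+ 2 / (4 * B ^+ 2)] compares to
    [expR (eta * lambda_bar eta B / 16 * d ^+ 2)]. *)
Lemma exp_concave_midpoint (R : realType) (V : lmodType R) (X : set V)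
    (f : V -> R) (eta B : R) (x x' : V) :
  0 < eta -> 0 < B -> exp_concave eta X f -> X x -> X x' ->
  `|f x - f x'| <= B ->
  f (2^-1 *: x + 2^-1 *: x')
    <= (f x + f x') / 2 - lambda_bar eta B / 16 * (f x - f x') ^+ 2.
Proof.
move=> eta0 B0 fc xX xX' dB.
have half : Itv.spec (Itv.num_sem (R:=R)) (Itv.Real `[0%Z, 1%Z]) (2^-1 : R).
  by rewrite /= /Itv.num_sem /= in_itv /= realE; apply/and3P; split; lra.
have := fc (Itv.Def half) x x'; rewrite !inE => /(_ xX xX').
have -> : conv (Itv.Def half) (x : convex_lmodType V) (x' : convex_lmodType V) =
   2^-1 *: x + 2^-1 *: x' :> V.
  by rewrite /conv /= /unstable.onem; congr (_ + _ *: _); lra.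
set mid := 2^-1 *: x + _; rewrite !convRE /= /unstable.onem => fcm.
set a := f x in dB fcm *; set b := f x' in dB fcm *.
set d := a - b in dB *.
have dB2 : d ^+ 2 <= B ^+ 2.
  by rewrite -real_normK ?num_real // ler_sqr ?nnegrE ?(ltW B0).
set th := d ^+ 2 / (4 * B ^+ 2).
have B2 : 0 < 4 * B ^+ 2 by rewrite mulr_gt0 ?exprn_gt0.
have th01 : 0 <= th <= 1.
  rewrite /th divr_ge0 ?sqr_ge0 ?(ltW B2) //= ler_pdivrMr // mul1r.
  by have := sqr_ge0 B; lra.
have z0 : 0 <= eta ^+ 2 * B ^+ 2 / 2.
  by apply: divr_ge0 => //; apply: mulr_ge0; exact: sqr_ge0.
have bern := expR_mul_ln_le th01 z0.
set L := ln _ in bern.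
have thz : th * (eta ^+ 2 * B ^+ 2 / 2) = (eta * d / 2) ^+ 2 / 2.
  by rewrite /th; field; rewrite gt_eqF.
have ch := cosh_lower (eta * d / 2).
have thL : eta * (lambda_bar eta B / 16 * d ^+ 2) <= th * L.
  have -> : th * L = eta * ((4 * L / (eta * B ^+ 2)) / 16 * d ^+ 2).
    by rewrite /th; field; rewrite !gt_eqF.
  rewrite ler_pM2l //; apply: ler_wpM2r; first exact: sqr_ge0.
  by apply: ler_wpM2r; [lra|rewrite ge_min lexx].
have key : expR (- eta * ((a + b) / 2 - lambda_bar eta B / 16 * d ^+ 2))
    <= expR (- eta * f mid).
  have -> : - eta * ((a + b) / 2 - lambda_bar eta B / 16 * d ^+ 2)
     = - eta * ((a + b) / 2) + eta * (lambda_bar eta B / 16 * d ^+ 2) by ring.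
  rewrite expRD.
  apply: (@le_trans _ _ (expR (- eta * ((a + b) / 2)) *
     ((expR (eta * d / 2) + expR (- (eta * d / 2))) / 2))).
    apply: ler_wpM2l; first exact: expR_ge0.
    apply: (@le_trans _ _ (expR (th * L))); first by rewrite ler_expR.
    by apply: (le_trans bern); rewrite thz; lra.
  rewrite mulrA mulrDr -!expRD.
  have -> : - eta * ((a + b) / 2) + eta * d / 2 = - eta * b.
    by rewrite /d; field.
  have -> : - eta * ((a + b) / 2) - eta * d / 2 = - eta * a.
    by rewrite /d; field.
  lra.
move: key; rewrite ler_expR !mulNr lerN2 ler_pM2l //.
Qed.

(** * Products of adapted functions over random sequences *)

Section PrefixBigop.
Variables (A : Type) (idx : A) (op : Monoid.com_law idx) (T : nat).

Lemma big_ltnS (f : 'I_T -> A) n (nT : (n < T)%N) :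
  \big[op/idx]_(t < T | (t < n.+1)%N) f t
    = op (\big[op/idx]_(t < T | (t < n)%N) f t) (f (Ordinal nT)).
Proof.
rewrite (bigD1 (Ordinal nT)) //= Monoid.mulmC; congr (op _ _).
by apply: eq_bigl => t; rewrite ltnS -val_eqE /= [(t < n)%N]ltn_neqAle andbC.
Qed.

Lemma big_ltn_ord (f : 'I_T -> A) :
  \big[op/idx]_(t < T | (t < T)%N) f t = \big[op/idx]_(t < T) f t.
Proof. by apply: eq_bigl => t; rewrite ltn_ord. Qed.

End PrefixBigop.

Section Adapted.
Variables (R : realFieldType) (D : finType) (T : nat).
Implicit Types (w : {ffun 'I_T -> D}) (q : {ffun 'I_T -> D} -> 'I_T -> R).

Definition resample w (t : 'I_T) (d : D) : {ffun 'I_T -> D} :=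
  [ffun s => if s == t then d else w s].

Lemma resample_id w t d : resample w t d t = d.
Proof. by rewrite ffunE eqxx. Qed.

Lemma resample_neq w t d s : s != t -> resample w t d s = w s.
Proof. by rewrite ffunE => /negbTE ->. Qed.

(** It is enough to ask that resampling one later round has no effect, as any
    change of the future is a succession of such resamplings. *)
Definition adapted q := forall w (t s : 'I_T) d,
  (t < s)%N -> q (resample w s d) t = q w t.

Lemma adaptedM q q' : adapted q -> adapted q' ->
  adapted (fun w t => q w t * q' w t).
Proof. by move=> aq aq' w t s d ts; rewrite aq // aq'. Qed.

(** The exchange [(w, d) |-> (resample w t d, w t)] is an involution. *)
Lemma sum_resample (G : {ffun 'I_T -> D} -> R) t :
  \sum_w \sum_d G (resample w t d) = #|D|%:R * \sum_w G w.
Proof.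
pose h (x : {ffun 'I_T -> D} * D) := (resample x.1 t x.2, x.1 t).
have hK : involutive h.
  move=> [w d]; rewrite /h /= resample_id; congr (_, _).
  by apply/ffunP => s; rewrite !ffunE; case: eqP => // ->.
rewrite pair_bigA /= (reindex_inj (inv_inj hK)) /=.
transitivity (\sum_(x : {ffun 'I_T -> D} * D) G x.1).
  by apply: eq_bigr => x _; have := hK x; rewrite /h /= => /(congr1 fst) /= ->.
rewrite -(pair_bigA _ (fun w _ => G w)) /= mulr_sumr; apply: eq_bigr => w _.
by rewrite sumr_const mulr_natl.
Qed.

(** One step of the tower property, for the counting measure: the first [n]
    factors do not see round [n], which can thus be summed out on its own. *)
Lemma sum_prefix_step q n (nT : (n < T)%N) : adapted q ->
  #|D|%:R * \sum_w \prod_(t < T | (t < n.+1)%N) q w t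
    = \sum_w (\prod_(t < T | (t < n)%N) q w t)
        * \sum_d q (resample w (Ordinal nT) d) (Ordinal nT).
Proof.
move=> aq; rewrite -(sum_resample _ (Ordinal nT)); apply: eq_bigr => w _.
rewrite mulr_sumr; apply: eq_bigr => d _; rewrite (big_ltnS _ _ nT).
by congr (_ * _); apply: eq_bigr => t tn; rewrite aq.
Qed.

Lemma sum_prefix0 q :
  \sum_w \prod_(t < T | (t < 0)%N) q w t = #|D|%:R ^+ T.
Proof.
rewrite (eq_bigr (fun _ => 1)) => [|w _]; last by rewrite big_pred0.
by rewrite sumr_const card_ffun card_ord natrX.
Qed.

Lemma sum_prod_le1 q : (0 < #|D|)%N -> (forall w t, 0 <= q w t) -> adapted q ->
  (forall w t, \sum_d q (resample w t d) t <= 1) ->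
  \sum_w \prod_(t < T) q w t <= 1.
Proof.
move=> D0 q0 aq q1.
have D0R : 0 < #|D|%:R :> R by rewrite ltr0n.
suff H n : (n <= T)%N ->
    #|D|%:R ^+ n * \sum_w \prod_(t < T | (t < n)%N) q w t <= #|D|%:R ^+ T.
  have := H T (leqnn T); rewrite -[leRHS]mulr1 ler_pM2l ?exprn_gt0 //.
  by rewrite (eq_bigr _ (fun w _ => big_ltn_ord _ (q w))).
elim: n => [|n IH] nT; first by rewrite expr0 mul1r sum_prefix0.
apply: le_trans (IH (ltnW nT)); rewrite exprSr -mulrA (sum_prefix_step nT aq).
apply: ler_wpM2l; first by rewrite exprn_ge0 ?ltW.
apply: ler_sum => w _; rewrite -[leRHS]mulr1; apply: ler_wpM2l => //.
exact: prodr_ge0.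
Qed.

Lemma sum_prod_eq1 q : (0 < #|D|)%N -> adapted q ->
  (forall w t, \sum_d q (resample w t d) t = 1) ->
  \sum_w \prod_(t < T) q w t = 1.
Proof.
move=> D0 aq q1.
have D0R : 0 < #|D|%:R :> R by rewrite ltr0n.
suff H n : (n <= T)%N ->
    #|D|%:R ^+ n * \sum_w \prod_(t < T | (t < n)%N) q w t = #|D|%:R ^+ T.
  have := H T (leqnn T); rewrite -[RHS]mulr1.
  move/(mulfI (expf_neq0 T (lt0r_neq0 D0R))) => e; rewrite -[RHS]e.
  by apply: eq_bigr => w _; rewrite big_ltn_ord.
elim: n => [|n IH] nT; first by rewrite expr0 mul1r sum_prefix0.
rewrite -(IH (ltnW nT)) exprSr -mulrA (sum_prefix_step nT aq); congr (_ * _).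
by apply: eq_bigr => w _; rewrite q1 mulr1.
Qed.

End Adapted.

(** * One round *)

Lemma sqr_between (R : realDomainType) (u v y : R) :
  u <= y <= v -> y ^+ 2 <= u ^+ 2 + v ^+ 2.
Proof.
move=> /andP[uy yv]; have [y0|/ltW y0] := lerP 0 y.
  apply: (@le_trans _ _ (v ^+ 2)); last by rewrite lerDr sqr_ge0.
  by rewrite ler_sqr ?nnegrE // (le_trans y0).
apply: (@le_trans _ _ (u ^+ 2)); last by rewrite lerDl sqr_ge0.
rewrite -sqrrN -[leRHS]sqrrN ler_sqr ?nnegrE ?lerN2 ?oppr_ge0 //.
exact: le_trans y0.
Qed.

Section Round.
Variables (R : realType) (K m : nat).
Hypothesis mK : (m_tilde m <= K)%N.

Local Notation scale := (K%:R / (m_tilde m)%:R : R).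

Lemma m_tilde_gt0 : (0 < m_tilde m)%N.
Proof. by rewrite /m_tilde leq_max orbT. Qed.

Lemma scale_ge1 : 1 <= scale.
Proof.
by rewrite ler_pdivlMr ?ltr0n ?m_tilde_gt0 // mul1r ler_nat.
Qed.

Lemma scale_ge0 : 0 <= scale.
Proof. exact: le_trans scale_ge1. Qed.

Lemma bin_neq0 : 'C(K, m_tilde m)%:R != 0 :> R.
Proof. by rewrite pnatr_eq0 -lt0n bin_gt0. Qed.

Lemma sum_unif_subset_pred (P : pred {set 'I_K}) :
  \sum_U unif_subset R m U * (P U)%:R
    = #|[set U : {set 'I_K} | (#|U| == m_tilde m) && P U]%SET|%:R
      / 'C(K, m_tilde m)%:R.
Proof.
rewrite cardsE -sum1_card natr_sum mulr_suml [RHS]big_mkcond /=.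
apply: eq_bigr => U _; rewrite /unif_subset unfold_in /=.
by case: (_ == _); case: (P U); rewrite /= ?mulr0 ?mulr1 ?mul0r.
Qed.

Lemma sum_unif_subset : \sum_U @unif_subset R K m U = 1.
Proof.
transitivity (\sum_U unif_subset R m U * (@predT {set 'I_K} U)%:R).
  by apply: eq_bigr => U _; rewrite mulr1.
rewrite sum_unif_subset_pred -[RHS](divff bin_neq0); congr (_%:R / _).
transitivity #|[set U : {set 'I_K} | #|U| == m_tilde m]%SET|.
  by apply: eq_card => U; rewrite !inE andbT.
by rewrite card_draws card_ord.
Qed.

(** The subsets that avoid [i] are those of the [K - 1] other experts; Pascal's
    rule and [K * 'C(K - 1, k - 1) = k * 'C(K, k)] count the ones that hold it. *)
Lemma sum_unif_subset_mem i :
  \sum_U @unif_subset R K m U * (scale * (i \in U)%:R) = 1.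
Proof.
transitivity (scale * \sum_U @unif_subset R K m U * (i \in U)%:R).
  by rewrite mulr_sumr; apply: eq_bigr => U _; rewrite mulrCA.
rewrite (sum_unif_subset_pred (fun U => i \in U)).
set A := [set U : {set 'I_K} | _]%SET.
have K0 : (0 < K)%N := leq_trans m_tilde_gt0 mK.
have cA : (m_tilde m * 'C(K, m_tilde m) = K * #|A|)%N.
  have -> : #|A| = 'C(K.-1, (m_tilde m).-1).
    have cB : #|[set U : {set 'I_K} | U \subset [set~ i]%SET & #|U| == m_tilde m]%SET|
       = 'C(K.-1, m_tilde m) by rewrite cards_draws cardsC1 card_ord.
    have : (#|A| + 'C(K.-1, m_tilde m) = 'C(K, m_tilde m))%N.
      rewrite -cB -[in RHS](card_ord K) -card_draws.
      rewrite -(cardsID [set U : {set 'I_K} | i \in U]%SET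
         [set U : {set 'I_K} | #|U| == m_tilde m]%SET).
      congr (_ + _)%N; apply: eq_card => U; rewrite !inE //.
      congr (_ && _); rewrite -disjoints1 finset.disjoints_subset.
      by rewrite -[RHS]finset.setCS finset.setCK.
    rewrite -[in RHS](prednK K0) -(prednK m_tilde_gt0) binS addnC /=.
    by move/addnI.
  by rewrite -[in LHS](prednK m_tilde_gt0) -mul_bin_diag.
have m0 : (m_tilde m)%:R != 0 :> R by rewrite pnatr_eq0 -lt0n m_tilde_gt0.
have /(congr1 (fun n => n%:R : R)) := cA; rewrite !natrM => e.
have b0 := bin_neq0.
by rewrite mulrACA -e -invfM divff ?mulf_neq0.
Qed.

Section Mean.
Variable p : 'I_K -> R.
Hypothesis p0 : forall i, 0 <= p i.
Hypothesis p1 : \sum_i p i = 1.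

(** The conditional mean, given the past, of a function of the draws of a round
    at which the experts have the weights [p]. *)
Definition mean (f : draw K -> R) : R :=
  \sum_(d : draw K) p d.1.1 * p d.1.2 * unif_subset R m d.2 * f d.

Lemma unif_subset_ge0 U : 0 <= @unif_subset R K m U.
Proof. by rewrite divr_ge0 ?ler0n. Qed.

Lemma mean_le f g : (forall d, f d <= g d) -> mean f <= mean g.
Proof.
move=> fg; apply: ler_sum => d _; apply: ler_wpM2l => //.
by rewrite !mulr_ge0 ?unif_subset_ge0.
Qed.

Lemma meanD f g : mean (fun d => f d + g d) = mean f + mean g.
Proof. by rewrite -big_split; apply: eq_bigr => d _; rewrite mulrDr. Qed.

Lemma meanZ c f : mean (fun d => c * f d) = c * mean f.
Proof. by rewrite mulr_sumr; apply: eq_bigr => d _; rewrite mulrCA. Qed.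

Lemma mean_sum (I : finType) (f : I -> draw K -> R) :
  mean (fun d => \sum_i f i d) = \sum_i mean (f i).
Proof.
by rewrite exchange_big /=; apply: eq_bigr => d _; rewrite mulr_sumr.
Qed.

Lemma mean_indep (f : 'I_K -> 'I_K -> R) (h : {set 'I_K} -> R) :
  mean (fun d => f d.1.1 d.1.2 * h d.2)
    = (\sum_i \sum_j p i * p j * f i j) * \sum_U unif_subset R m U * h U.
Proof.
rewrite /mean -(pair_bigA _ (fun ij U =>
   p ij.1 * p ij.2 * unif_subset R m U * (f ij.1 ij.2 * h U))) /=.
rewrite -(pair_bigA _ (fun i j => \sum_U
   p i * p j * unif_subset R m U * (f i j * h U))) /=.
rewrite mulr_suml; apply: eq_bigr => i _.
rewrite mulr_suml; apply: eq_bigr => j _.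
by rewrite mulr_sumr; apply: eq_bigr => U _; rewrite mulrACA.
Qed.

Lemma mean_IJ (f : 'I_K -> 'I_K -> R) :
  mean (fun d => f d.1.1 d.1.2) = \sum_i \sum_j p i * p j * f i j.
Proof.
have := mean_indep f (fun=> 1).
rewrite (eq_bigr (unif_subset R m)) => [|U _]; last by rewrite mulr1.
rewrite sum_unif_subset mulr1 => <-.
by apply: eq_bigr => d _; rewrite mulr1.
Qed.

Lemma sum_fst (f : 'I_K -> R) :
  \sum_i \sum_j p i * p j * f i = \sum_i p i * f i.
Proof.
apply: eq_bigr => i _; rewrite -mulr_suml -mulr_sumr p1.
by rewrite mulr1.
Qed.

Lemma sum_snd (f : 'I_K -> R) :
  \sum_i \sum_j p i * p j * f j = \sum_j p j * f j.
Proof.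
rewrite exchange_big -[RHS]sum_fst; apply: eq_bigr => i _.
by apply: eq_bigr => j _; rewrite [p j * _]mulrC.
Qed.

Lemma mean_I (f : 'I_K -> R) : mean (fun d => f d.1.1) = \sum_i p i * f i.
Proof. by rewrite (mean_IJ (fun i _ => f i)) sum_fst. Qed.

Lemma mean_J (f : 'I_K -> R) : mean (fun d => f d.1.2) = \sum_i p i * f i.
Proof. by rewrite (mean_IJ (fun _ j => f j)) sum_snd. Qed.

Lemma mean_cst c : mean (fun=> c) = c.
Proof. by rewrite (mean_I (fun=> c)) -mulr_suml p1 mul1r. Qed.

(** An expert is explored with probability [m_tilde m / K], whence the factor
    [scale]; the draw of the subset is independent of the expert played. *)
Lemma mean_importance (i : 'I_K) (f : 'I_K -> R) :
  mean (fun d => scale * (i \in d.2)%:R * f d.1.1) = \sum_j p j * f j.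
Proof.
have := mean_indep (fun j _ => f j) (fun U => scale * (i \in U)%:R).
rewrite sum_unif_subset_mem mulr1 sum_fst => <-.
by apply: eq_bigr => d _; congr (_ * _); rewrite mulrC.
Qed.

Section Losses.
Variables (x : 'I_K -> R) (lambda lb B : R).
Hypothesis xB : forall i j, `|x i - x j| <= B.
Hypothesis lambda0 : 0 < lambda.
Hypothesis B0 : 0 < B.
Hypothesis lbB : lb * B <= 1.
Hypothesis lambda_lb : lambda * scale <= lb / 64.

Definition avg_loss : R := \sum_i p i * x i.

(** Twice the variance of the loss under [p]. *)
Definition spread : R := \sum_i \sum_j p i * p j * (x i - x j) ^+ 2.

(** The estimated loss of an expert relative to the one that is played; only
    this difference is multiplied by the large factor [scale]. *)
Definition rel_loss (d : draw K) (i : 'I_K) : R :=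
  scale * (i \in d.2)%:R * (x i - x d.1.1).

Lemma spread_ge0 : 0 <= spread.
Proof.
apply: sumr_ge0 => i _; apply: sumr_ge0 => j _.
by apply: mulr_ge0; [exact: mulr_ge0|exact: sqr_ge0].
Qed.

Lemma lambda_le : lambda <= lb / 64.
Proof.
apply: le_trans lambda_lb; rewrite -[leLHS]mulr1 ler_pM2l //.
exact: scale_ge1.
Qed.

Lemma lb_gt0 : 0 < lb.
Proof. by have := lambda_le; have := lambda0; lra. Qed.

Lemma lambdaB_le : lambda * B <= 1 / 64.
Proof.
by have := ler_wpM2r (ltW B0) lambda_le; have := lbB; lra.
Qed.

Lemma sum_pB (c : R) : \sum_i p i * (x i - c) = avg_loss - c.
Proof.
rewrite (eq_bigr (fun i => p i * x i - p i * c)) => [|i _].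
  by rewrite sumrB -mulr_suml p1 mul1r.
by rewrite mulrBr.
Qed.

(** Centring at the mean makes the cross terms vanish. *)
Lemma spreadE : spread = 2 * \sum_i p i * (x i - avg_loss) ^+ 2.
Proof.
set a := avg_loss; rewrite /spread.
transitivity (\sum_i \sum_j (p i * p j * (x i - a) ^+ 2
   + p i * p j * (x j - a) ^+ 2 + (-2 * (p i * (x i - a))) * (p j * (x j - a)))).
  by apply: eq_bigr => i _; apply: eq_bigr => j _; ring.
under eq_bigr => i _ do
  rewrite !big_split /= -(mulr_sumr _ _ _ (-2 * _)) sum_pB subrr mulr0 addr0.
by rewrite big_split /= sum_fst sum_snd mulr_natl mulr2n.
Qed.

Lemma rel_loss_small d i : `|lambda * rel_loss d i| <= 1 / 64.
Proof.
rewrite /rel_loss mulrA mulrA normrM.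
apply: (@le_trans _ _ (lb / 64 * B)); last by have := lbB; lra.
apply: ler_pM => //.
have ls0 : 0 <= lambda * scale by rewrite mulr_ge0 ?(ltW lambda0) ?scale_ge0.
rewrite ger0_norm; last by rewrite mulr_ge0.
apply: le_trans lambda_lb; rewrite -[leRHS]mulr1 ler_wpM2l //.
by case: (_ \in _).
Qed.

Lemma mean_rel_loss i : mean (rel_loss ^~ i) = x i - avg_loss.
Proof.
rewrite (mean_importance i (fun j => x i - x j)).
rewrite (eq_bigr (fun j => - (p j * (x j - x i)))) => [|j _]; last by ring.
by rewrite sumrN sum_pB opprB.
Qed.

Lemma mean_rel_loss_sqr i :
  mean (fun d => rel_loss d i ^+ 2) = scale * \sum_j p j * (x i - x j) ^+ 2.
Proof.
rewrite -(mean_importance i (fun j => (x i - x j) ^+ 2)) -meanZ.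
apply: eq_bigr => d _; congr (_ * _); rewrite /rel_loss.
by case: (_ \in _); rewrite /= ?mulr0 ?mul0r ?mulr0 ?expr0n ?mulr1 //=; ring.
Qed.

(** The square in the exponent absorbs the variance of the estimate: only its
    mean, [x i - avg_loss], remains. *)
Lemma mean_expert_le1 i :
  mean (fun d => expR (lambda * rel_loss d i - (lambda * rel_loss d i) ^+ 2
                       - lambda * (x i - avg_loss))) <= 1.
Proof.
set y := lambda * (x i - avg_loss).
apply: (@le_trans _ _ (mean (fun d =>
   expR (- y) * (1 + lambda * rel_loss d i)))).
  apply: mean_le => d; rewrite addrC expRD ler_wpM2l ?expR_ge0 //.
  apply: expR_subsqr_le; apply: le_trans (rel_loss_small d i) _; lra.
rewrite meanZ meanD mean_cst meanZ mean_rel_loss -/y expRN mulrC.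
by rewrite ler_pdivrMr ?expR_gt0 // mul1r expR_ge1Dx.
Qed.

(** The first-order terms cancel: the average under [p] of the losses relative
    to an expert that is itself drawn from [p] has mean zero. The second-order
    terms add up to [3 * lambda ^+ 2 * scale * spread]. *)
Lemma mean_mixture_le1 :
  mean (fun d => (\sum_i p i * expR (- (lambda * rel_loss d i)
                                     + (lambda * rel_loss d i) ^+ 2))
                 * expR (- (3 / 64 * lambda * lb * spread))) <= 1.
Proof.
set y := 3 / 64 * lambda * lb * spread.
apply: (@le_trans _ _ (mean (fun d => expR (- y) *
   \sum_i p i * (1 + (- lambda) * rel_loss d i
                 + 3 * lambda ^+ 2 * rel_loss d i ^+ 2)))).
  apply: mean_le => d; rewrite mulrC ler_wpM2l ?expR_ge0 //.
  apply: ler_sum => i _; apply: ler_wpM2l => //.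
  apply: le_trans (expR_addsqr_le (rel_loss_small d i)) _.
  by rewrite mulNr exprMn; lra.
rewrite meanZ mean_sum.
under eq_bigr => i _ do rewrite meanZ !meanD mean_cst !meanZ mean_rel_loss
   mean_rel_loss_sqr.
have -> : \sum_i p i * (1 + - lambda * (x i - avg_loss) +
    3 * lambda ^+ 2 * (scale * \sum_j p j * (x i - x j) ^+ 2))
   = 1 + 3 * lambda ^+ 2 * scale * spread.
  transitivity (\sum_i (p i + - lambda * (p i * (x i - avg_loss))
     + 3 * lambda ^+ 2 * scale * (p i * \sum_j p j * (x i - x j) ^+ 2))).
    by apply: eq_bigr => i _; ring.
  rewrite !big_split /= p1 -!mulr_sumr sum_pB subrr mulr0 addr0.
  congr (_ + _ * _); apply: eq_bigr => i _; rewrite mulr_sumr.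
  by apply: eq_bigr => j _; rewrite mulrA.
rewrite expRN mulrC ler_pdivrMr ?expR_gt0 // mul1r.
apply: le_trans (expR_ge1Dx _); rewrite lerD2l /y.
have h := ler_wpM2l (mulr_ge0 (ltW lambda0) spread_ge0) lambda_lb.
by move: h; rewrite expr2; set s := K%:R / _; lra.
Qed.

(** With [z] replaced by its upper bound, the exponent has mean [- lambda * lb / 16 * spread]
    before the last term is added, and its second moment is at most
    [lambda ^+ 2 * spread <= lambda * lb / 64 * spread]; what remains,
    [(1 / 16 - 1 / 64) * lambda * lb * spread], is the last term. *)
Lemma mean_midpoint_le1 (z : 'I_K -> 'I_K -> R) :
  (forall i j, z i j <= (x i + x j) / 2 - lb / 16 * (x i - x j) ^+ 2) ->
  mean (fun d => expR (lambda * (z d.1.1 d.1.2 - avg_loss)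
                       + 3 / 64 * lambda * lb * spread)) <= 1.
Proof.
move=> zx; set y := 3 / 64 * lambda * lb * spread.
pose X i j := (x i + x j) / 2 - lb / 16 * (x i - x j) ^+ 2 - avg_loss.
have avgB i : `|x i - avg_loss| <= B.
  have -> : x i - avg_loss = \sum_j p j * (x i - x j).
    rewrite (eq_bigr (fun j => - (p j * (x j - x i)))) => [|j _]; last by ring.
    by rewrite sumrN sum_pB opprB.
  apply: le_trans (ler_norm_sum _ _ _) _; rewrite -[B]mul1r -p1 mulr_suml.
  by apply: ler_sum => j _; rewrite normrM ger0_norm // ler_wpM2l.
(* [X i j] lies between the centred losses of [i] and [j], since the quadratic
   gain is at most [`|x i - x j| / 2]. *)
have Xbetween i j : (x i - avg_loss <= X i j <= x j - avg_loss)
                 \/ (x j - avg_loss <= X i j <= x i - avg_loss).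
  have g0 : 0 <= lb / 16 * (x i - x j) ^+ 2.
    apply: mulr_ge0 (sqr_ge0 _); have := lb_gt0; lra.
  have g1 : lb / 16 * (x i - x j) ^+ 2 <= `|x i - x j| / 2.
    rewrite -[_ ^+ 2]real_normK ?num_real // expr2.
    have := normr_ge0 (x i - x j); set n := `|_| => n0.
    have : lb * n <= 1.
      by apply: le_trans lbB; rewrite ler_wpM2l ?(ltW lb_gt0) ?xB.
    by move/(ler_wpM2r n0); lra.
  move: g0 g1; rewrite /X; set g := lb / 16 * _.
  case: (lerP (x i) (x j)) => ij.
    by move=> g0 g1; left; lra.
  by move=> g0 g1; right; lra.
have Xsqr i j : X i j ^+ 2 <= (x i - avg_loss) ^+ 2 + (x j - avg_loss) ^+ 2.
  case: (Xbetween i j) => /sqr_between //.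
  by rewrite addrC.
have Xsmall i j : `|lambda * X i j| <= 1 / 4.
  rewrite normrM gtr0_norm //.
  have : `|X i j| <= B.
    move: (avgB i) (avgB j); rewrite !ler_norml.
    by case: (Xbetween i j); lra.
  by move/(ler_wpM2l (ltW lambda0)); have := lambdaB_le; lra.
apply: (@le_trans _ _ (mean (fun d => expR y * (1 +
   (lambda / 2 * (x d.1.1 - avg_loss) + lambda / 2 * (x d.1.2 - avg_loss)
    + - (lambda * lb / 16) * (x d.1.1 - x d.1.2) ^+ 2
    + (lambda ^+ 2 * (x d.1.1 - avg_loss) ^+ 2
       + lambda ^+ 2 * (x d.1.2 - avg_loss) ^+ 2)))))).
  apply: mean_le => -[[i j] U] /=; rewrite addrC expRD ler_wpM2l ?expR_ge0 //.
  apply: (@le_trans _ _ (expR (lambda * X i j))).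
    by rewrite ler_expR ler_pM2l // lerD2r.
  apply: le_trans (expR_le_poly2 (Xsmall i j)) _.
  have := ler_wpM2l (sqr_ge0 lambda) (Xsqr i j); rewrite exprMn /X; lra.
rewrite meanZ !meanD mean_cst !meanZ (mean_I (fun i => x i - avg_loss))
   (mean_J (fun i => x i - avg_loss)) (mean_I (fun i => (x i - avg_loss) ^+ 2))
   (mean_J (fun i => (x i - avg_loss) ^+ 2))
   (mean_IJ (fun i j => (x i - x j) ^+ 2)) sum_pB subrr -/spread.
set v := \sum_i _; have sv : spread = 2 * v by exact: spreadE.
have le1 : lambda ^+ 2 * (2 * v) <= lambda * lb / 64 * spread.
  rewrite -sv ler_wpM2r ?spread_ge0 // expr2 -mulrA ler_pM2l //.
  exact: lambda_le.
rewrite -[expR y]invrK -expRN mulrC ler_pdivrMr ?expR_gt0 // mul1r.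
apply: le_trans (expR_ge1Dx _).
have ey : y = 3 / 64 * lambda * lb * spread by [].
rewrite -sv in le1; rewrite ey; move: le1; rewrite sv; lra.
Qed.

End Losses.
End Mean.
End Round.

(** * The algorithm *)

Section Run.
Variables (R : realType) (K T m : nat) (lambda : R) (loss : 'I_K -> 'I_T -> R).
Hypothesis K0 : (0 < K)%N.
Hypothesis mK : (m_tilde m <= K)%N.
Implicit Types (w : run K T) (t s : 'I_T) (d : draw K) (i : 'I_K).

Local Notation p_hat := (p_hat m lambda loss).
Local Notation weight := (weight m lambda loss).
Local Notation L_hat := (L_hat m loss).
Local Notation V_hat := (V_hat m loss).
Local Notation loss_hat := (loss_hat m loss).
Local Notation v_hat := (v_hat m loss).
Local Notation draw_prob := (draw_prob m lambda loss).
Local Notation run_prob := (run_prob m lambda loss).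

Definition rel_loss_hat w i t : R := loss_hat w i t - loss (drawI w t) t.

Lemma rel_loss_hatE w i t :
  rel_loss_hat w i t = rel_loss m (loss ^~ t) (w t) i.
Proof. by rewrite /rel_loss_hat /Defs.loss_hat /rel_loss /drawI /drawU; ring. Qed.

Lemma loss_hat_resample w s d i t : t != s ->
  loss_hat (resample w s d) i t = loss_hat w i t.
Proof. by move=> ts; rewrite /Defs.loss_hat /drawU /drawI resample_neq. Qed.

Lemma v_hat_resample w s d i t : t != s ->
  v_hat (resample w s d) i t = v_hat w i t.
Proof. by move=> ts; rewrite /Defs.v_hat loss_hat_resample // /drawI resample_neq. Qed.

Lemma weight_resample w s d i t : (t <= s)%N ->
  weight (resample w s d) i t = weight w i t.
Proof.
move=> ts; have neq (r : 'I_T) : (r < t)%N -> r != s.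
  by move=> rt; rewrite -val_eqE /= ltn_eqF // (leq_trans rt).
have eL : L_hat (resample w s d) i t = L_hat w i t.
  by apply: eq_bigr => r rt; rewrite loss_hat_resample // neq.
have eV : V_hat (resample w s d) i t = V_hat w i t.
  by apply: eq_bigr => r rt; rewrite v_hat_resample // neq.
by rewrite /Defs.weight eL eV.
Qed.

Lemma p_hat_resample w s d i t : (t <= s)%N ->
  p_hat (resample w s d) i t = p_hat w i t.
Proof.
move=> ts; rewrite /Defs.p_hat weight_resample //; congr (_ / _).
by apply: eq_bigr => j _; rewrite weight_resample.
Qed.

Lemma sum_weight_gt0 w t : 0 < \sum_i weight w i t.
Proof.
rewrite (bigD1 (Ordinal K0)) //=; apply: ltr_pwDl; first exact: expR_gt0.
by apply: sumr_ge0 => i _; exact: expR_ge0.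
Qed.

Lemma p_hat_ge0 w i t : 0 <= p_hat w i t.
Proof. by rewrite divr_ge0 ?expR_ge0 // ltW // sum_weight_gt0. Qed.

Lemma sum_p_hat w t : \sum_i p_hat w i t = 1.
Proof. by rewrite -mulr_suml divff // gt_eqF // sum_weight_gt0. Qed.

Lemma draw_prob_ge0 w t : 0 <= draw_prob w t.
Proof.
by apply: mulr_ge0 (unif_subset_ge0 _ _ _); apply: mulr_ge0; exact: p_hat_ge0.
Qed.

Lemma run_prob_ge0 w : 0 <= run_prob w.
Proof. by apply: prodr_ge0 => t _; exact: draw_prob_ge0. Qed.

Lemma draw_prob_adapted : adapted draw_prob.
Proof.
move=> w t s d ts; rewrite /Defs.draw_prob !p_hat_resample ?(ltnW ts) //.
by rewrite /drawI /drawJ /drawU resample_neq // -val_eqE /= ltn_eqF.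
Qed.

Lemma draw_prob_resample w t d : draw_prob (resample w t d) t =
  p_hat w d.1.1 t * p_hat w d.1.2 t * unif_subset R m d.2.
Proof.
by rewrite /Defs.draw_prob !p_hat_resample // /drawI /drawJ /drawU resample_id.
Qed.

Lemma card_draw_gt0 : (0 < #|{: draw K}|)%N.
Proof.
apply/card_gt0P.
by exists (Ordinal K0, Ordinal K0, finset.set0).
Qed.

Lemma sum_run_prob : \sum_w run_prob w = 1.
Proof.
apply: sum_prod_eq1 card_draw_gt0 draw_prob_adapted _ => w t.
rewrite -[RHS](mean_cst mK (sum_p_hat w t) 1); apply: eq_bigr => d _.
by rewrite draw_prob_resample mulr1.
Qed.

(** A product of nonnegative adapted factors, each of conditional mean at most
    [1], is the terminal value of a nonnegative supermartingale. *)
Lemma supermartingale_mean (g : run K T -> 'I_T -> R) :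
  (forall w t, 0 <= g w t) -> adapted g ->
  (forall w t, mean m (p_hat w ^~ t) (fun d => g (resample w t d) t) <= 1) ->
  \sum_w run_prob w * \prod_(t < T) g w t <= 1.
Proof.
move=> g0 ag g1; under eq_bigr => w _ do rewrite -big_split /=.
apply: sum_prod_le1 card_draw_gt0 _ (adaptedM draw_prob_adapted ag) _ => w t.
  by rewrite mulr_ge0 ?draw_prob_ge0.
apply: le_trans (g1 w t); apply: ler_sum => d _.
by rewrite draw_prob_resample.
Qed.

(** The potential [\sum_i weight w i t] starts at [K], and its ratio between
    two rounds is the mean of the multiplicative updates under [p_hat]. *)
Lemma prod_mean_weight w :
  K%:R * \prod_(t < T) (\sum_i p_hat w i t *
      expR (- lambda * loss_hat w i t + lambda ^+ 2 * v_hat w i t))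
    = \sum_i expR (- lambda * (\sum_(t < T) loss_hat w i t)
                   + lambda ^+ 2 * \sum_(t < T) v_hat w i t).
Proof.
pose W n i := expR (- lambda * (\sum_(t < T | (t < n)%N) loss_hat w i t)
                    + lambda ^+ 2 * \sum_(t < T | (t < n)%N) v_hat w i t).
pose S t := \sum_i p_hat w i t *
      expR (- lambda * loss_hat w i t + lambda ^+ 2 * v_hat w i t).
suff H n : (n <= T)%N ->
    K%:R * \prod_(t < T | (t < n)%N) S t = \sum_i W n i.
  have := H T (leqnn T); rewrite big_ltn_ord => ->.
  by apply: eq_bigr => i _; rewrite /W !big_ltn_ord.
elim: n => [|n IH] nT.
  rewrite big_pred0 // mulr1 (eq_bigr (fun=> 1)) => [|i _].
    by rewrite sumr_const card_ord.
  by rewrite /W !big_pred0 // !mulr0 addr0 expR0.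
rewrite (big_ltnS _ _ nT) mulrA IH ?(ltnW nT) //.
set t := Ordinal nT; rewrite /S /Defs.p_hat.
rewrite mulr_sumr; apply: eq_bigr => i _.
have -> : \sum_j W n j = \sum_j weight w j t by [].
rewrite mulrA mulrCA divff ?mulr1; last by rewrite gt_eqF // sum_weight_gt0.
rewrite -expRD /W /L_hat /V_hat; congr expR.
rewrite !(big_ltnS _ _ nT) /Defs.L_hat /Defs.V_hat /=; ring.
Qed.

(** Subtracting the loss of the played expert [drawI w t] from all estimates
    multiplies the potential by the same factor as each of its terms. *)
Lemma prod_mean_rel_weight w i :
  \prod_(t < T) expR (- (lambda * rel_loss_hat w i t)
                      + (lambda * rel_loss_hat w i t) ^+ 2)
  <= K%:R * \prod_(t < T) (\sum_j p_hat w j t *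
      expR (- (lambda * rel_loss_hat w j t)
            + (lambda * rel_loss_hat w j t) ^+ 2)).
Proof.
have shift j t : expR (- (lambda * rel_loss_hat w j t)
            + (lambda * rel_loss_hat w j t) ^+ 2)
   = expR (lambda * loss (drawI w t) t) *
     expR (- lambda * loss_hat w j t + lambda ^+ 2 * v_hat w j t).
  rewrite -expRD; congr expR; rewrite /Defs.v_hat /rel_loss_hat; ring.
under eq_bigr => t _ do rewrite shift.
under [in leRHS]eq_bigr => t _.
  under eq_bigr => j _ do rewrite shift mulrCA.
  rewrite -mulr_sumr.
  over.
rewrite !big_split /= [leRHS]mulrCA prod_mean_weight.
apply: ler_wpM2l; first by apply: prodr_ge0 => t _; exact: expR_ge0.
rewrite -expR_sum big_split /= -!mulr_sumr (bigD1 i) //= lerDl.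
by apply: sumr_ge0 => j _; exact: expR_ge0.
Qed.

(** Markov's inequality for the product of three factors of mean at most [1]:
    where the product is at least [delta ^- 3], one of the factors, and so
    their sum, is at least [delta^-1]. *)
Lemma Pr_ge (E : pred (run K T)) (delta : R) (gA gB gC : run K T -> R) :
  0 < delta ->
  (forall w, [/\ 0 <= gA w, 0 <= gB w & 0 <= gC w]) ->
  \sum_w run_prob w * gA w <= 1 ->
  \sum_w run_prob w * gB w <= 1 ->
  \sum_w run_prob w * gC w <= 1 ->
  (forall w, ~~ E w -> delta ^- 3 <= gA w * gB w * gC w) ->
  1 - 3 * delta <= Pr m lambda loss E.
Proof.
move=> d0 g0 hA hB hC bad.
rewrite -[X in X - _]sum_run_prob (bigID E) /= -/(Pr _ _ _ E) lerBlDr lerD2l.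
apply: (@le_trans _ _ (\sum_w run_prob w * (delta * (gA w + gB w + gC w)))).
  rewrite [leLHS]big_mkcond /=; apply: ler_sum => w _.
  have [a0 b0 c0] := g0 w.
  case: ifPn => [Ew|_]; last first.
    by rewrite mulr_ge0 ?run_prob_ge0 // mulr_ge0 ?(ltW d0) ?addr_ge0.
  rewrite -[leLHS]mulr1 ler_wpM2l ?run_prob_ge0 // mulrC -ler_pdivrMr // div1r.
  have s0 : 0 <= gA w + gB w + gC w by rewrite !addr_ge0.
  rewrite -(@ler_pXn2r _ 3) ?nnegrE ?invr_ge0 ?(ltW d0) //.
  rewrite exprVn; apply: le_trans (bad w Ew) _.
  rewrite exprS expr2 mulrA; apply: ler_pM; rewrite ?mulr_ge0 //; last lra.
  by apply: ler_pM => //; lra.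
rewrite (eq_bigr (fun w => delta * (run_prob w * gA w)
   + delta * (run_prob w * gB w) + delta * (run_prob w * gC w))).
  rewrite !big_split /= -!mulr_sumr -!mulrDr [leRHS]mulrC ler_pM2l //.
  apply: le_trans (lerD (lerD hA hB) hC) _; lra.
by move=> w _; ring.
Qed.

Section Bounds.
Variables (z : 'I_T -> 'I_K -> 'I_K -> R) (lb B : R).
Hypothesis lossB : forall i j t, `|loss i t - loss j t| <= B.
Hypothesis lambda0 : 0 < lambda.
Hypothesis B0 : 0 < B.
Hypothesis lbB : lb * B <= 1.
Hypothesis lambda_lb : lambda * (K%:R / (m_tilde m)%:R) <= lb / 64.
Hypothesis zP : forall t i j, z t i j <=
  (loss i t + loss j t) / 2 - lb / 16 * (loss i t - loss j t) ^+ 2.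

Local Notation avg w t := (avg_loss (p_hat w ^~ t) (loss ^~ t)).
Local Notation var w t := (spread (p_hat w ^~ t) (loss ^~ t)).

(** The exponential of the error made when the relative loss of [i] is
    estimated, with the correction by the square. *)
Definition expert_factor i w t : R :=
  expR (lambda * rel_loss_hat w i t - (lambda * rel_loss_hat w i t) ^+ 2
        - lambda * (loss i t - avg w t)).

(** The change of the total weight, divided by the bound on its mean. *)
Definition mixture_factor w t : R :=
  (\sum_i p_hat w i t * expR (- (lambda * rel_loss_hat w i t)
                              + (lambda * rel_loss_hat w i t) ^+ 2))
  * expR (- (3 / 64 * lambda * lb * var w t)).

(** The exponential of the excess of the loss of the prediction over the
    average loss, with the part of the gain of the midpoint that pays for
    [mixture_factor]. *)
Definition midpoint_factor w t : R :=
  expR (lambda * (z t (drawI w t) (drawJ w t) - avg w t)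
        + 3 / 64 * lambda * lb * var w t).

Lemma avg_resample w s d t : (t <= s)%N -> avg (resample w s d) t = avg w t.
Proof. by move=> ts; apply: eq_bigr => i _; rewrite p_hat_resample. Qed.

Lemma var_resample w s d t : (t <= s)%N -> var (resample w s d) t = var w t.
Proof.
by move=> ts; apply: eq_bigr => i _; apply: eq_bigr => j _;
   rewrite !p_hat_resample.
Qed.

Lemma mean_expert_factor i :
  \sum_w run_prob w * \prod_(t < T) expert_factor i w t <= 1.
Proof.
apply: supermartingale_mean => [w t|w t s d ts|w t]; first exact: expR_ge0.
  have tns : t != s by rewrite -val_eqE /= ltn_eqF.
  by rewrite /expert_factor (avg_resample _ _ (ltnW ts)) !rel_loss_hatE
    (resample_neq _ _ tns).
apply: le_trans (mean_expert_le1 mK (p_hat_ge0 w ^~ t) (sum_p_hat w t)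
  (fun i j => lossB i j t) lambda0 lbB lambda_lb i).
apply: mean_le => [j|d]; first exact: p_hat_ge0.
by rewrite /expert_factor (avg_resample _ _ (leqnn t)) !rel_loss_hatE resample_id.
Qed.

Lemma mean_mixture_factor :
  \sum_w run_prob w * \prod_(t < T) mixture_factor w t <= 1.
Proof.
apply: supermartingale_mean => [w t|w t s d ts|w t].
- rewrite mulr_ge0 ?expR_ge0 //; apply: sumr_ge0 => i _.
  by rewrite mulr_ge0 ?p_hat_ge0 ?expR_ge0.
- have tns : t != s by rewrite -val_eqE /= ltn_eqF.
  rewrite /mixture_factor (var_resample _ _ (ltnW ts)); congr (_ * _).
  apply: eq_bigr => i _.
  by rewrite (p_hat_resample _ _ _ (ltnW ts)) !rel_loss_hatE
    (resample_neq _ _ tns).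
apply: le_trans (mean_mixture_le1 mK (p_hat_ge0 w ^~ t) (sum_p_hat w t)
  (fun i j => lossB i j t) lambda0 lbB lambda_lb).
apply: mean_le => [j|d]; first exact: p_hat_ge0.
rewrite /mixture_factor (var_resample _ _ (leqnn t)); apply: ler_wpM2r; first exact: expR_ge0.
by apply: ler_sum => i _; rewrite p_hat_resample // !rel_loss_hatE resample_id.
Qed.

Lemma mean_midpoint_factor :
  \sum_w run_prob w * \prod_(t < T) midpoint_factor w t <= 1.
Proof.
apply: supermartingale_mean => [w t|w t s d ts|w t]; first exact: expR_ge0.
  have tns : t != s by rewrite -val_eqE /= ltn_eqF.
  by rewrite /midpoint_factor (avg_resample _ _ (ltnW ts))
    (var_resample _ _ (ltnW ts)) /drawI /drawJ (resample_neq _ _ tns).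
apply: le_trans (mean_midpoint_le1 mK (p_hat_ge0 w ^~ t) (sum_p_hat w t)
  (fun i j => lossB i j t) lambda0 B0 lbB lambda_lb (zP t)).
apply: mean_le => [j|d]; first exact: p_hat_ge0.
by rewrite /midpoint_factor (avg_resample _ _ (leqnn t))
  (var_resample _ _ (leqnn t)) /drawI /drawJ resample_id.
Qed.

(** The average losses and the spreads cancel in the product of the factors. *)
Lemma prod_factors_ge i w :
  expR (lambda * (\sum_(t < T) z t (drawI w t) (drawJ w t)
                  - \sum_(t < T) loss i t)) / K%:R
  <= \prod_(t < T) expert_factor i w t * \prod_(t < T) mixture_factor w t
     * \prod_(t < T) midpoint_factor w t.
Proof.
rewrite ler_pdivrMr ?ltr0n //.
pose M := \prod_(t < T) (\sum_j p_hat w j t *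
  expR (- (lambda * rel_loss_hat w j t) + (lambda * rel_loss_hat w j t) ^+ 2)).
pose N := \prod_(t < T) expR (- (3 / 64 * lambda * lb * var w t)).
have -> : \prod_(t < T) mixture_factor w t = M * N by rewrite -big_split.
rewrite (_ : _ * _ * _ * _ =
   \prod_(t < T) expert_factor i w t * N * \prod_(t < T) midpoint_factor w t
   * (K%:R * M)); last by ring.
apply: le_trans (ler_wpM2l _ (prod_mean_rel_weight w i)); last first.
  by rewrite !mulr_ge0 //; apply: prodr_ge0 => t _; exact: expR_ge0.
rewrite le_eqVlt; apply/orP; left; apply/eqP.
rewrite -!big_split /= -sumrB mulr_sumr expR_sum; apply: eq_bigr => t _.
rewrite /expert_factor /midpoint_factor -!expRD; congr expR; ring.
Qed.

Lemma Pr_regret (E : pred (run K T)) i (delta : R) : 0 < delta ->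
  (forall w, ~~ E w -> 3 * lambda^-1 * ln (K%:R / delta)
     <= \sum_(t < T) z t (drawI w t) (drawJ w t) - \sum_(t < T) loss i t) ->
  1 - 3 * delta <= Pr m lambda loss E.
Proof.
move=> d0 bad.
apply: (Pr_ge d0 _ (mean_expert_factor i) mean_mixture_factor
  mean_midpoint_factor) => w.
  split; apply: prodr_ge0 => t _; rewrite ?expR_ge0 //.
  rewrite mulr_ge0 ?expR_ge0 //; apply: sumr_ge0 => j _.
  by rewrite mulr_ge0 ?p_hat_ge0 ?expR_ge0.
move=> /bad regw; apply: le_trans (prod_factors_ge i w).
have K0R : 0 < K%:R :> R by rewrite ltr0n.
have Kd : 0 < K%:R / delta by rewrite divr_gt0.
rewrite ler_pdivlMr //.
apply: (@le_trans _ _ (expR (ln (K%:R / delta) *+ 3))); last first.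
  rewrite ler_expR; apply: le_trans (ler_wpM2l (ltW lambda0) regw).
  by rewrite [3 * _]mulrC -mulrA mulVKf ?gt_eqF // [leRHS]mulr_natl.
rewrite -[_ *+ 3]mulr_natl expRM_natl lnK ?posrE //.
rewrite exprMn mulrC exprVn ler_pM2r ?invr_gt0 ?exprn_gt0 //.
by rewrite exprS ler_peMr // -natrX ler1n expn_gt0 K0.
Qed.

End Bounds.
End Run.

(** * The regret bound *)

Lemma inf_range_min (R : realType) (K : nat) (f : 'I_K -> R) :
  (0 < K)%N -> exists i, f i <= inf (range f).
Proof.
move=> K0; case: (@arg_minP _ _ _ (Ordinal K0) xpredT f isT) => i _ fi.
exists i; apply: lb_le_inf; first by exists (f i), i.
by move=> _ [j _ <-]; exact: fi.
Qed.

Lemma loss_rangeP (R : realType) (V : lmodType R) (X : set V) (f : V -> R)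
    (B : R) (x x' : V) :
  (loss_range X f <= B%:E)%E -> X x -> X x' -> `|f x - f x'| <= B.
Proof.
move=> h xX xX'; rewrite -lee_fin; apply: le_trans h.
by apply: ereal_sup_ubound; exists x => //; exists x'.
Qed.

Lemma leq_m_tilde (m : nat) : (2 <= m)%N -> (m <= (2 * m_tilde m).+1)%N.
Proof. by case: m => [|[|[|m]]] //; rewrite /m_tilde (maxn_idPl _) //; lia. Qed.

Lemma lambda_barB_le1 (R : realType) (eta B : R) :
  0 < B -> lambda_bar eta B * B <= 1.
Proof. by move=> B0; rewrite -ler_pdivlMr // ge_min lexx orbT. Qed.

Unset Implicit Arguments.

Theorem theorem4p1 (R : realType) :
  exists c : R,
  forall (V : topologicalLmodType R) (X : set V) (Y : Type) (l : V -> Y -> R)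
    (B eta : R) (K T p m : nat) (IC : bool)
    (F : 'I_K -> 'I_T -> V) (y : 'I_T -> Y) (lambda delta : R),
  closed X ->
  convex_set (X : set (convex_lmodType V)) ->
  0 < B ->
  0 < eta ->
  (forall z : Y, exp_concave eta X (fun x => l x z)) ->
  (forall z : Y, (loss_range X (fun x => l x z) <= B%:E)%E) ->
  (forall (i : 'I_K) (t : 'I_T), X (F i t)) ->
  (m <= K)%N ->
  (p = 2%N /\ (3 <= m)%N) \/ [/\ p = 2%N, m = 2%N & IC = false] ->
  0 < lambda < (m%:R - 1) / (128 * K%:R) * lambda_bar eta B ->
  0 < delta < 1 ->
  1 - 8 * delta <=
    Pr m lambda (expert_loss l F y)
      (fun w => regret l F y w
                <= c * lambda^-1 * ln (lambda_bar eta B * K%:R / (lambda * delta))).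
Proof.
exists 3 => V X Y l B eta K T p m IC F y lambda delta _ _ B0 eta0 lconc lrange
  FX mK mP /andP[lambda0 lambda_lt] /andP[delta0 delta1].
have m2 : (2 <= m)%N by case: mP => [[_ /ltnW]|[_ ->]].
have K0 : (0 < K)%N by apply: leq_trans mK; apply: ltnW.
have mtK : (m_tilde m <= K)%N.
  by apply: leq_trans mK; rewrite geq_max leq_subr ltnW.
have K0R : 0 < K%:R :> R by rewrite ltr0n.
have mt0R : 0 < (m_tilde m)%:R :> R by rewrite ltr0n m_tilde_gt0.
set lb := lambda_bar eta B in lambda_lt *.
have lb0 : 0 < lb.
  have c0 : 0 < (m%:R - 1) / (128 * K%:R) :> R.
    by rewrite divr_gt0 ?mulr_gt0 // subr_gt0 ltr1n.
  by rewrite -(pmulr_rgt0 _ c0) (lt_trans lambda0).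
have mR : m%:R - 1 <= 2 * (m_tilde m)%:R :> R.
  by rewrite lerBlDr -natrM natr1 ler_nat leq_m_tilde.
have lambda_lb : lambda * (K%:R / (m_tilde m)%:R) <= lb / 64.
  rewrite mulrA ler_pdivrMr //.
  have := ltW lambda_lt; rewrite -(ler_pM2r K0R) => /le_trans; apply.
  rewrite (_ : _ * K%:R = (m%:R - 1) * (lb / 128)); last by field; rewrite gt_eqF.
  have := ler_wpM2r (ltW lb0) mR; lra.
have lossB i j t : `|expert_loss l F y i t - expert_loss l F y j t| <= B.
  exact: loss_rangeP (lrange (y t)) (FX i t) (FX j t).
pose z t i j := l (2^-1 *: F i t + 2^-1 *: F j t) (y t).
have zP t i j : z t i j <=
    (expert_loss l F y i t + expert_loss l F y j t) / 2
    - lb / 16 * (expert_loss l F y i t - expert_loss l F y j t) ^+ 2.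
  exact: exp_concave_midpoint eta0 B0 (lconc (y t)) (FX i t) (FX j t)
    (lossB i j t).
have [i imin] := inf_range_min
  (fun i : 'I_K => \sum_(t < T) expert_loss l F y i t) K0.
apply: (@le_trans _ _ (1 - 3 * delta)); first lra.
apply: (Pr_regret K0 mtK lossB lambda0 B0 (lambda_barB_le1 eta B0) lambda_lb zP
  (i := i) delta0) => w; rewrite -ltNge => /ltW.
rewrite /regret -/(z _ _ _) => regw.
apply: le_trans (lerB (lexx _) imin); apply: le_trans regw.
apply: ler_wpM2l; first by rewrite mulr_ge0 // invr_ge0 ltW.
have lambda_lb' := lambda_le mtK lambda0 lambda_lb.
(* [lambda <= lb], so [K / delta] is at most the argument of the logarithm. *)
rewrite ler_ln ?posrE ?divr_gt0 ?mulr_gt0 //.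
have -> : lb * K%:R / (lambda * delta) = lb / lambda * (K%:R / delta).
  by rewrite invfM mulrACA.
rewrite ler_peMl ?divr_ge0 ?(ltW delta0) // ler_pdivlMr // mul1r.
by apply: le_trans lambda_lb' _; lra.
Qed.
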